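(* Let $M$ be the complement of the figure-eight knot. The affine variety $X(M)\subset\mathbb{C}^3$ is defined by the equations $$x=y,\qquad (x^2-z-2)\bigl(z^2-(1+x^2)z+2x^2-1\bigr)=0.$$ In particular, $X(M)$ can be identified with the affine plane curve $\{(x,z)\in\mathbb{C}^2 : (x^2-z-2)(z^2-(1+x^2)z+2x^2-1)=0\}$. It has two irreducible components.
   Context: $M$ is the complement in $S^3$ of the figure-eight knot, with $$\pi_1(M)=\langle\alpha,\beta\mid\beta^{-1}\alpha^{-1}\beta\alpha\beta^{-1}\alpha\beta\alpha^{-1}\beta^{-1}\alpha\rangle,$$ where $\alpha,\beta$ are meridians. The character $\chi=\mathrm{tr}\,\rho$ of a representation $\rho\in R(M)=\mathrm{Hom}(\pi_1(M),SL_2(\mathbb{C}))$ is determined by $\chi(\alpha),\chi(\beta),\chi(\alpha\beta)$, and the character variety $X(M)$ is the image of the map $t:R(M)\to\mathbb{C}^3$, $t(\rho)=(\chi(\alpha),\chi(\beta),\chi(\alpha\beta))$; $(x,y,z)$ are the affine coordinates on $\mathbb{C}^3$. *)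

(* Defs.v *)
From HB Require Import structures.
From mathcomp Require Import all_boot all_order all_algebra.
From mathcomp Require Import boolp classical_sets reals.
From mathcomp Require Import complex.
From mathcomp Require Import mpoly.

Set Implicit Arguments.
Unset Strict Implicit.
Unset Printing Implicit Defensive.

Import GRing.Theory.
Local Open Scope classical_set_scope.
Local Open Scope ring_scope.

(** * Groups given by a presentation *)

(* [(x, true)] is the generator [x] and [(x, false)] is its inverse. *)
Definition word (X : Type) := seq (X * bool).

Definition letter_inv (X : Type) (l : X * bool) : X * bool := (l.1, ~~ l.2).

Definition word_inv (X : Type) (w : word X) : word X :=
  rev (map (@letter_inv X) w).

(* [<X | rels>] is the monoid of words modulo the congruence generated by
   [l l^-1 = 1], for every letter [l], and by [r = 1], for every relator [r]. *)
Inductive pres_eq (X : eqType) (rels : seq (word X)) : word X -> word X -> Prop :=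
| pres_cancel u v l : pres_eq rels (u ++ [:: l; letter_inv l] ++ v) (u ++ v)
| pres_rel u v r : r \in rels -> pres_eq rels (u ++ r ++ v) (u ++ v)
| pres_refl u : pres_eq rels u u
| pres_sym u v : pres_eq rels u v -> pres_eq rels v u
| pres_trans u v w : pres_eq rels u v -> pres_eq rels v w -> pres_eq rels u w.

Section Presented.
Variables (X : choiceType) (rels : seq (word X)).

Lemma letter_invK : involutive (@letter_inv X).
Proof. by case=> x b; rewrite /letter_inv /= negbK. Qed.

Lemma word_invK : involutive (@word_inv X).
Proof.
by move=> w; rewrite /word_inv map_rev revK -map_comp map_id_in // => l _ /=;
  rewrite letter_invK.
Qed.

Lemma word_inv_cat (u v : word X) :
  word_inv (u ++ v) = word_inv v ++ word_inv u.
Proof. by rewrite /word_inv map_cat rev_cat. Qed.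

Lemma pres_eq_ctx (a b u v : word X) :
  pres_eq rels u v -> pres_eq rels (a ++ u ++ b) (a ++ v ++ b).
Proof.
elim=> {u v} [u v l|u v r r_rel|u|u v _|u v w _ Huv _ Hvw].
- have := pres_cancel rels (a ++ u) (v ++ b) l.
  by rewrite -!catA.
- have := pres_rel (a ++ u) (v ++ b) r_rel.
  by rewrite -!catA.
- exact: pres_refl.
- exact: pres_sym.
- exact: pres_trans Huv Hvw.
Qed.

Lemma pres_eq_cat (u u' v v' : word X) :
  pres_eq rels u u' -> pres_eq rels v v' -> pres_eq rels (u ++ v) (u' ++ v').
Proof.
move=> Hu Hv.
have := pres_eq_ctx [::] v Hu; rewrite /= => /pres_trans; apply.
by have := pres_eq_ctx u' [::] Hv; rewrite !cats0.
Qed.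

Lemma pres_eqVr (w : word X) : pres_eq rels (w ++ word_inv w) [::].
Proof.
elim: w => [|l w IHw]; first exact: pres_refl.
have -> : (l :: w) ++ word_inv (l :: w) =
    [:: l] ++ (w ++ word_inv w) ++ [:: letter_inv l].
  by rewrite /word_inv /= rev_cons -cats1 catA.
apply: (pres_trans (pres_eq_ctx [:: l] [:: letter_inv l] IHw)).
exact: (pres_cancel rels [::] [::] l).
Qed.

Lemma pres_eqVl (w : word X) : pres_eq rels (word_inv w ++ w) [::].
Proof. by have := pres_eqVr (word_inv w); rewrite word_invK. Qed.

Lemma pres_eq_inv (u v : word X) :
  pres_eq rels u v -> pres_eq rels (word_inv u) (word_inv v).
Proof.
move=> Huv.
have H1 : pres_eq rels (word_inv u ++ (v ++ word_inv v)) (word_inv u).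
  have := pres_eq_cat (pres_refl rels (word_inv u)) (pres_eqVr v).
  by rewrite cats0.
apply: pres_trans (pres_sym H1) _; rewrite catA.
have H2 : pres_eq rels (word_inv u ++ v) [::].
  apply: pres_trans (pres_eqVl u).
  by apply: pres_eq_cat; [exact: pres_refl | exact: pres_sym].
exact: pres_eq_cat H2 (pres_refl rels (word_inv v)).
Qed.

Definition pres_eqb (u v : word X) : bool := `[< pres_eq rels u v >].

Lemma pres_eqb_refl : reflexive pres_eqb.
Proof. by move=> u; apply/asboolP; exact: pres_refl. Qed.

Lemma pres_eqb_sym : ssrbool.symmetric pres_eqb.
Proof.
by move=> u v; apply/idP/idP => /asboolP H; apply/asboolP; exact: pres_sym.
Qed.

Lemma pres_eqb_trans : transitive pres_eqb.
Proof.
by move=> v u w /asboolP H1 /asboolP H2; apply/asboolP; exact: pres_trans H2.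
Qed.

Canonical pres_equiv := EquivRel pres_eqb pres_eqb_refl pres_eqb_sym pres_eqb_trans.

Local Open Scope quotient_scope.

Definition presented_group := {eq_quot pres_equiv}.
HB.instance Definition _ := Choice.on presented_group.
HB.instance Definition _ := EqQuotient.on presented_group.

Definition word_class (w : word X) : presented_group := \pi_presented_group w.

Lemma word_class_eqP (u v : word X) :
  word_class u = word_class v <-> pres_eq rels u v.
Proof. by split=> [/eqmodP /asboolP|H] //; apply/eqmodP/asboolP. Qed.

Lemma word_class_repr (g : presented_group) : word_class (repr g) = g.
Proof. exact: reprK. Qed.

Definition pres_mul (g h : presented_group) := word_class (repr g ++ repr h).
Definition pres_inv (g : presented_group) := word_class (word_inv (repr g)).

Lemma word_class_mul (u v : word X) :
  pres_mul (word_class u) (word_class v) = word_class (u ++ v).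
Proof.
by apply/word_class_eqP/pres_eq_cat; apply/word_class_eqP; rewrite word_class_repr.
Qed.

Lemma word_class_inv (u : word X) :
  pres_inv (word_class u) = word_class (word_inv u).
Proof.
by apply/word_class_eqP/pres_eq_inv; apply/word_class_eqP; rewrite word_class_repr.
Qed.

Lemma pres_mulA : associative pres_mul.
Proof.
move=> f g h; rewrite -(word_class_repr f) -(word_class_repr g).
by rewrite -(word_class_repr h) !word_class_mul catA.
Qed.

Lemma pres_mul1 : left_id (word_class [::]) pres_mul.
Proof. by move=> g; rewrite -(word_class_repr g) word_class_mul. Qed.

Lemma pres_mulr1 : right_id (word_class [::]) pres_mul.
Proof. by move=> g; rewrite -(word_class_repr g) word_class_mul cats0. Qed.

Lemma pres_mulV : left_inverse (word_class [::]) pres_inv pres_mul.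
Proof.
move=> g; rewrite -(word_class_repr g) word_class_inv word_class_mul.
exact/word_class_eqP/pres_eqVl.
Qed.

Lemma pres_mulrV : right_inverse (word_class [::]) pres_inv pres_mul.
Proof.
move=> g; rewrite -(word_class_repr g) word_class_inv word_class_mul.
exact/word_class_eqP/pres_eqVr.
Qed.

HB.instance Definition _ := isGroup.Build presented_group
  pres_mulA pres_mul1 pres_mulr1 pres_mulV pres_mulrV.

Definition pres_gen (x : X) : presented_group := word_class [:: (x, true)].

End Presented.

(** * The group of the figure-eight knot *)

(* Generators: [0] is alpha and [1] is beta.  The relator is
   beta^-1 alpha^-1 beta alpha beta^-1 alpha beta alpha^-1 beta^-1 alpha. *)
Definition fig8_relator : word 'I_2 :=
  let a := (0, true) in let a' := (0, false) in
  let b := (1, true) in let b' := (1, false) in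
  [:: b'; a'; b; a; b'; a; b; a'; b'; a].

Definition fig8_group := presented_group [:: fig8_relator].
HB.instance Definition _ := Group.on fig8_group.

Definition fig8_alpha : fig8_group := pres_gen _ 0.
Definition fig8_beta : fig8_group := pres_gen _ 1.

(** * The group [SL_2] *)

Section SL2.
Variable K : fieldType.

Record SL2 := MkSL2 { SL2_mx :> 'M[K]_2; _ : \det SL2_mx == 1 }.

HB.instance Definition _ := [isSub for SL2_mx].
HB.instance Definition _ := [Choice of SL2 by <:].

Lemma SL2_det (A : SL2) : \det (A : 'M[K]_2) = 1.
Proof. by apply/eqP; exact: (valP A). Qed.

Lemma SL2_unit (A : SL2) : (A : 'M[K]_2) \in unitmx.
Proof. by rewrite unitmxE SL2_det unitr1. Qed.

Lemma SL2_one_proof : \det (1%:M : 'M[K]_2) == 1.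
Proof. by rewrite det1. Qed.

Lemma SL2_mul_proof (A B : SL2) : \det ((A : 'M[K]_2) *m B) == 1.
Proof. by rewrite det_mulmx !SL2_det mulr1. Qed.

Lemma SL2_inv_proof (A : SL2) : \det (invmx (A : 'M[K]_2)) == 1.
Proof. by rewrite det_inv SL2_det invr1. Qed.

Definition SL2_one := MkSL2 SL2_one_proof.
Definition SL2_mul (A B : SL2) := MkSL2 (SL2_mul_proof A B).
Definition SL2_inv (A : SL2) := MkSL2 (SL2_inv_proof A).

Lemma SL2_mulA : associative SL2_mul.
Proof. by move=> A B C; apply/val_inj; rewrite /= mulmxA. Qed.

Lemma SL2_mul1 : left_id SL2_one SL2_mul.
Proof. by move=> A; apply/val_inj; rewrite /= mul1mx. Qed.

Lemma SL2_mulr1 : right_id SL2_one SL2_mul.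
Proof. by move=> A; apply/val_inj; rewrite /= mulmx1. Qed.

Lemma SL2_mulV : left_inverse SL2_one SL2_inv SL2_mul.
Proof. by move=> A; apply/val_inj; rewrite /= mulVmx ?SL2_unit. Qed.

Lemma SL2_mulrV : right_inverse SL2_one SL2_inv SL2_mul.
Proof. by move=> A; apply/val_inj; rewrite /= mulmxV ?SL2_unit. Qed.

HB.instance Definition _ := isGroup.Build SL2
  SL2_mulA SL2_mul1 SL2_mulr1 SL2_mulV SL2_mulrV.

End SL2.

(** * Affine algebraic sets

    Affine [n]-space is [n.-tuple K]. *)

Section Zariski.
Variable K : fieldType.

Definition zero_locus n (S : set {mpoly K[n]}) : set (n.-tuple K) :=
  [set v | forall p, S p -> p.@[tnth v] = 0].

Definition zariski_closed n (Z : set (n.-tuple K)) : Prop :=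
  exists S : set {mpoly K[n]}, Z = zero_locus S.

Definition zariski_irreducible n (Z : set (n.-tuple K)) : Prop :=
  Z !=set0 /\
  forall A B : set (n.-tuple K), zariski_closed A -> zariski_closed B ->
    Z `<=` A `|` B -> Z `<=` A \/ Z `<=` B.

(* The maximal irreducible subsets; they are automatically closed in [V]. *)
Definition irreducible_components n (V : set (n.-tuple K)) :
    set (set (n.-tuple K)) :=
  [set Z | [/\ zariski_irreducible Z, Z `<=` V &
    forall W, zariski_irreducible W -> W `<=` V -> Z `<=` W -> W = Z]].

Definition polynomial_map n m (f : n.-tuple K -> m.-tuple K) : Prop :=
  exists P : m.-tuple {mpoly K[n]},
    forall v, f v = [tuple (tnth P i).@[tnth v] | i < m].

Definition algebraic_iso n m (V : set (n.-tuple K)) (W : set (m.-tuple K))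
    (f : n.-tuple K -> m.-tuple K) : Prop :=
  exists g : m.-tuple K -> n.-tuple K,
    [/\ polynomial_map f, polynomial_map g,
        (forall v, V v -> W (f v) /\ g (f v) = v) &
        (forall w, W w -> V (g w) /\ f (g w) = w)].

End Zariski.

(** * The character variety of the figure-eight knot complement *)

Section CharacterVariety.
Variable K : fieldType.

Definition character (G : groupType) (rho : {multiplicative G -> SL2 K})
    (g : G) : K := \tr (rho g : 'M[K]_2).

(* The domain is the set of representations [Hom(pi_1(M), SL_2)]: a
   multiplicative map between groups automatically preserves [1] and inverses. *)
Definition fig8_trace_map (rho : {multiplicative fig8_group -> SL2 K}) :
    3.-tuple K :=
  [tuple character rho fig8_alpha; character rho fig8_beta;
         character rho (fig8_alpha * fig8_beta)%g].

Definition fig8_character_variety : set (3.-tuple K) := range fig8_trace_map.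

(* Stated over any commutative ring so that it can be instantiated with
   indeterminates of polynomial rings of different dimensions. *)
Definition fig8_poly (A : comNzRingType) (x z : A) : A :=
  (x ^+ 2 - z - 2) * (z ^+ 2 - (1 + x ^+ 2) * z + 2 * x ^+ 2 - 1).

Definition fig8_equations : set {mpoly K[3]} :=
  let x := 'X_0 in let y := 'X_1 in let z := 'X_2 in
  [set x - y; fig8_poly x z].

Definition fig8_plane_curve : set (2.-tuple K) :=
  let x := 'X_0 in let z := 'X_1 in zero_locus [set fig8_poly x z].

Definition proj_xz (v : 3.-tuple K) : 2.-tuple K := [tuple tnth v 0; tnth v 2].

End CharacterVariety.

Arguments fig8_character_variety K : clear implicits.
Arguments fig8_equations K : clear implicits.
Arguments fig8_plane_curve K : clear implicits.
Arguments proj_xz K v : clear implicits.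

(* Main.v *)
From HB Require Import structures.
Require Import Defs.
From mathcomp Require Import all_boot all_order all_algebra.
From mathcomp Require Import boolp classical_sets reals complex mpoly.
From mathcomp Require Import ring zify.

(** Put [W = A^-1 B A B^-1].  The relator says [W A = B W], so a representation
    of the knot group is a pair [A], [B] in SL_2 with [W A = B W]
    ([presented_groupP], [fig8_relatorE]).  Such [A] and [B] are conjugate,
    whence [x = y].  When the traces agree, Cayley-Hamilton gives
    [W A - B W = phi(x, z) (A - B)] with [phi] the second factor of the equation
    ([fig8_matrix_identity]): either [phi(x, z) = 0], or [A = B] and
    [z = tr(A^2) = x^2 - 2].  Conversely, over an algebraically closed field
    every triple [(x, x, z)] consists of the traces of an explicit pair, and the
    same identity turns [phi(x, z) = 0] into the relation; for [z = x^2 - 2] one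
    takes [A = B] ([fig8_character_varietyE]).

    The projection to the [(x, z)]-plane is then an isomorphism onto the plane
    curve, and isomorphisms transport irreducible components.  The plane curve
    is the union of the parabola [z = x^2 - 2], irreducible because it is the
    graph of a polynomial, and of the curve [x^2 (z - 2) = z^2 - z - 1].  The
    latter is elliptic, so it has no rational parametrization; it is
    irreducible by a norm argument ([fig8_canonical_curve_irreducible]).
    Multiplied by a power of [z - 2], which has no zero on the curve, a
    polynomial function becomes [p0(z) + x p1(z)], and its norm down to the
    [z]-line is, up to the factor [z - 2],
    [(z - 2) p0^2 - (z^2 - z - 1) p1^2].  If a product vanishes on the curve, then
    so does the product of the norms, hence one norm is zero, and comparing
    the parities of the degrees of its two terms gives [p0 = p1 = 0]. *)

Set Implicit Arguments.
Unset Strict Implicit.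
Unset Printing Implicit Defensive.

Import GRing.Theory.
Local Open Scope classical_set_scope.
Local Open Scope ring_scope.

(** * Homomorphisms from a presented group *)

Section MultiplicativeGroups.
Variables (G H : groupType) (rho : {multiplicative G -> H}).
Local Open Scope group_scope.

Lemma multiplicative1 : rho 1 = 1.
Proof. by apply: (@mulgI _ (rho 1)); rewrite -gmulfM !mulg1. Qed.

Lemma multiplicativeV g : rho g^-1 = (rho g)^-1.
Proof. by apply: (@mulgI _ (rho g)); rewrite -gmulfM !mulgV multiplicative1. Qed.

End MultiplicativeGroups.

Section WordEvaluation.
Variables (X : choiceType) (H : groupType).
Local Open Scope group_scope.

(** The value of a word when each generator [x] is replaced by [f x]. *)
Definition word_eval (f : X -> H) (w : word X) : H :=
  foldr (fun l h => (if l.2 then f l.1 else (f l.1)^-1) * h) 1 w.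

Lemma word_eval_cat f u v : word_eval f (u ++ v) = word_eval f u * word_eval f v.
Proof. by elim: u => [|l u IHu] /=; rewrite ?mul1g // IHu mulgA. Qed.

Lemma word_eval_pres_eq f rels u v :
  (forall r, r \in rels -> word_eval f r = 1) ->
  pres_eq rels u v -> word_eval f u = word_eval f v.
Proof.
move=> f_rels; elim=> {u v} [u v [x b]|u v r /f_rels r1|//|//|u v w _ -> _ -> //].
  by rewrite !word_eval_cat; case: b; rewrite /= !mulg1 ?mulgV ?mulVg mul1g.
by rewrite !word_eval_cat r1 mul1g.
Qed.

Lemma morphism_word_class rels (rho : {multiplicative presented_group rels -> H}) w :
  rho (word_class rels w) = word_eval (fun x => rho (pres_gen rels x)) w.
Proof.
elim: w => [|[x b] w IHw]; first exact: multiplicative1.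
have -> : word_class rels ((x, b) :: w) =
    word_class rels [:: (x, b)] * word_class rels w.
  by rewrite [RHS]word_class_mul.
rewrite gmulfM IHw /=; congr (_ * _); case: b => //.
by rewrite -multiplicativeV; congr (rho _); rewrite [RHS]word_class_inv.
Qed.

(** The universal property of the presented group. *)
Lemma presented_groupP rels (f : X -> H) :
  (forall r, r \in rels -> word_eval f r = 1) ->
  exists rho : {multiplicative presented_group rels -> H},
    forall x, rho (pres_gen rels x) = f x.
Proof.
move=> f_rels.
pose rho (g : presented_group rels) := word_eval f (repr g).
have rhoE w : rho (word_class rels w) = word_eval f w.
  apply: word_eval_pres_eq f_rels _; apply/word_class_eqP.
  exact: word_class_repr.
have rhoM : {morph rho : g h / g * h}.
  by move=> g h; rewrite [LHS]rhoE word_eval_cat.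
pose rhoMul := isMultiplicative.Build _ _ rho rhoM.
pose rho' : {multiplicative presented_group rels -> H} := HB.pack rho rhoMul.
by exists rho' => x; rewrite [LHS]rhoE /= mulg1.
Qed.

End WordEvaluation.

(** * Representations of the figure-eight knot group *)

Lemma tuple2E T (v : 2.-tuple T) : v = [tuple tnth v 0; tnth v 1].
Proof.
apply: eq_from_tnth => -[[|[|//]] lti]; rewrite [RHS](tnth_nth (tnth v 0)) /=;
by congr tnth; apply: val_inj.
Qed.

Lemma tuple3E T (v : 3.-tuple T) : v = [tuple tnth v 0; tnth v 1; tnth v 2].
Proof.
apply: eq_from_tnth => -[[|[|[|//]]] lti]; rewrite [RHS](tnth_nth (tnth v 0)) /=;
by congr tnth; apply: val_inj.
Qed.

Lemma rmorph_fig8_poly (S T : comNzRingType) (f : {rmorphism S -> T}) x z :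
  f (fig8_poly x z) = fig8_poly (f x) (f z).
Proof.
by rewrite /fig8_poly !(rmorphM, rmorphB, rmorphD, rmorphXn, rmorph1, rmorph_nat).
Qed.

Section Fig8Representations.
Variable K : fieldType.

(** The relator of the knot group, rewritten as a conjugacy of [A] and [B]. *)
Definition fig8_relation (A B : SL2 K) :=
  let W := (A^-1 * B * A * B^-1)%g in (W * A = B * W)%g.

Lemma fig8_relatorE (H : groupType) (f : 'I_2 -> H) :
  let A := f 0 in let B := f 1 in let W := (A^-1 * B * A * B^-1)%g in
  word_eval f fig8_relator = 1%g <-> (W * A = B * W)%g.
Proof.
move=> A B W.
have -> : word_eval f fig8_relator = (B^-1 * (W * A * W^-1))%g.
  rewrite /word_eval /= -/A -/B /W !invgM !invgK mulg1.
  by rewrite !mulgA.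
split=> [/(canRL (mulKg _)) | ->]; last by rewrite mulgK mulVg.
by rewrite invgK mulg1 => /(canRL (mulgVK _)).
Qed.

Lemma ord2P (P : 'I_2 -> Prop) : P 0 -> P 1 -> forall i, P i.
Proof. by move=> P0 P1 [[|[|//]] lti]; [move: P0|move: P1]; congr P; apply: val_inj. Qed.

Lemma big_ord2 (F : 'I_2 -> K) : \sum_i F i = F 0 + F 1.
Proof. by rewrite !big_ord_recl big_ord0 addr0; congr (_ + F _); apply: val_inj. Qed.

Lemma mulmx2E m n (A : 'M[K]_(m, 2)) (B : 'M_(2, n)) i j :
  (A *m B) i j = A i 0 * B 0 j + A i 1 * B 1 j.
Proof. by rewrite mxE big_ord2. Qed.

Lemma matrix2P (A B : 'M[K]_2) :
  A 0 0 = B 0 0 -> A 0 1 = B 0 1 -> A 1 0 = B 1 0 -> A 1 1 = B 1 1 -> A = B.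
Proof. by move=> *; apply/matrixP; do 2!apply: ord2P. Qed.

Lemma det_mx2 (A : 'M[K]_2) : \det A = A 0 0 * A 1 1 - A 0 1 * A 1 0.
Proof.
rewrite (expand_det_row A 0) big_ord2 /cofactor !det_mx11 !mxE /=.
rewrite expr0 expr1 mul1r mulN1r mulrN.
by congr (_ * A _ _ - _ * A _ _); apply: val_inj.
Qed.

Lemma SL2_det_entries (A : SL2 K) : A 0 0 * A 1 1 = 1 + A 0 1 * A 1 0.
Proof. by rewrite -(SL2_det A) det_mx2; ring. Qed.

(** Cayley-Hamilton for a matrix of determinant 1. *)
Lemma SL2_inv_mx (A : SL2 K) :
  SL2_mx (A^-1)%g = (\tr (A : 'M[K]_2))%:M - (A : 'M[K]_2).
Proof.
have detA := SL2_det_entries A.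
apply: (can_inj (mulKmx (SL2_unit A))); rewrite mulmxV ?SL2_unit //.
by apply: matrix2P; rewrite /mxtrace !(mxE, big_ord2) /=; ring: detA.
Qed.

(** The factor [x%:M - M] is the inverse of [M], and likewise for [N], so that
    the left-hand side measures the failure of [fig8_relation]. *)
Lemma fig8_matrix_identity (M N : 'M[K]_2) :
  let x := \tr M in let z := \tr (M *m N) in
  let W := (x%:M - M) *m N *m M *m (x%:M - N) in
  \det M = 1 -> \det N = 1 -> \tr N = x ->
  W *m M - N *m W =
    (z ^+ 2 - (1 + x ^+ 2) * z + 2 * x ^+ 2 - 1) *: (M - N).
Proof.
move=> x z W; rewrite !det_mx2 {}/W {}/x {}/z /mxtrace !big_ord2 => detM detN trN.
have {}detM : M 0 0 * M 1 1 = 1 + M 0 1 * M 1 0 by rewrite -detM; ring.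
have {}trN : N 1 1 = M 0 0 + M 1 1 - N 0 0 by rewrite -trN; ring.
have {}detN : N 0 0 * N 0 0 = N 0 0 * M 0 0 + N 0 0 * M 1 1 - 1 - N 0 1 * N 1 0.
  by rewrite -detN trN; ring.
by apply: matrix2P; rewrite !(mulmx2E, mxE) /= trN; ring: detM detN.
Qed.

Lemma fig8_relation_mx (A B : SL2 K) :
  let x := \tr (SL2_mx A) in let z := \tr (SL2_mx A *m SL2_mx B) in
  \tr (SL2_mx B) = x ->
  fig8_relation A B <->
    (z ^+ 2 - (1 + x ^+ 2) * z + 2 * x ^+ 2 - 1) *: (SL2_mx A - SL2_mx B) = 0.
Proof.
move=> x z trBx; set W := (A^-1 * B * A * B^-1)%g.
have WE : SL2_mx W = (x%:M - SL2_mx A) *m SL2_mx B *m SL2_mx A *m (x%:M - SL2_mx B).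
  by rewrite -{2}trBx -!SL2_inv_mx.
rewrite -(fig8_matrix_identity (SL2_det A) (SL2_det B) trBx) -WE.
split=> [[/eqP] | /subr0_eq relAB]; first by rewrite -subr_eq0 => /eqP.
exact: val_inj.
Qed.

Lemma fig8_relation_tr (A B : SL2 K) :
  fig8_relation A B -> \tr (SL2_mx A) = \tr (SL2_mx B).
Proof.
rewrite /fig8_relation; set W := (_ * B^-1)%g => relAB.
have -> : B = (W * A * W^-1)%g by rewrite relAB mulgK.
by rewrite [RHS]mxtrace_mulC mulmxA mulVmx ?SL2_unit // mul1mx.
Qed.

Lemma mxtrace_sqr (M : 'M[K]_2) : \tr (M *m M) = (\tr M) ^+ 2 - 2 * \det M.
Proof. by rewrite det_mx2 /mxtrace !big_ord2 !mulmx2E; ring. Qed.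

Lemma fig8_character_varietyP (v : 3.-tuple K) :
  fig8_character_variety K v <-> exists A B : SL2 K, fig8_relation A B /\
    v = [tuple \tr (SL2_mx A); \tr (SL2_mx B); \tr (SL2_mx A *m SL2_mx B)].
Proof.
split=> [[rho _ <-]|[A [B [relAB ->]]]].
  exists (rho fig8_alpha), (rho fig8_beta); split; last first.
    by rewrite /fig8_trace_map /character gmulfM.
  apply/(fig8_relatorE (fun i => rho (pres_gen _ i))).
  rewrite -morphism_word_class -(multiplicative1 rho); congr (rho _).
  apply/word_class_eqP.
  exact: (pres_rel (rels := [:: fig8_relator]) [::] [::] (mem_head _ _)).
pose f (i : 'I_2) := if i == 0 then A else B.
have [|rho rhoE] := @presented_groupP _ _ [:: fig8_relator] f.
  by move=> r; rewrite inE => /eqP ->; apply/(fig8_relatorE f).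
exists rho => //; rewrite /fig8_trace_map /character gmulfM.
by rewrite [rho _]rhoE [rho fig8_beta]rhoE.
Qed.

Lemma zero_locus_fig8_equations (v : 3.-tuple K) :
  zero_locus (fig8_equations K) v <->
    tnth v 0 = tnth v 1 /\ fig8_poly (tnth v 0) (tnth v 2) = 0.
Proof.
split=> [v0 | [v01 v02] p [-> | ->]].
- split.
    by have := v0 _ (or_introl erefl); rewrite mevalB !mevalXU => /subr0_eq.
  by have := v0 _ (or_intror erefl); rewrite rmorph_fig8_poly /= !mevalXU.
- by rewrite mevalB !mevalXU v01 subrr.
- by rewrite rmorph_fig8_poly /= !mevalXU.
Qed.

Lemma fig8_character_variety_sub :
  fig8_character_variety K `<=` zero_locus (fig8_equations K).
Proof.
move=> v /fig8_character_varietyP [A [B [relAB ->]]].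
have trAB := fig8_relation_tr relAB.
apply/zero_locus_fig8_equations; split=> //; rewrite /fig8_poly !(tnth_nth 0) /=.
move/(fig8_relation_mx (esym trAB))/eqP: (relAB); rewrite scaler_eq0 => /orP[/eqP-> | ].
  by rewrite mulr0.
by rewrite subr_eq0 => /eqP<-; rewrite mxtrace_sqr SL2_det; ring.
Qed.

End Fig8Representations.

(** * The character variety over an algebraically closed field *)

Section Fig8ClosedField.
Variable K : closedFieldType.

Lemma closed_field_quadratic (b c : K) : exists t, t ^+ 2 = b * t + c.
Proof.
have [t tE] := @solve_monicpoly K 2 (fun i => if i == 0%N then c else b) isT.
by exists t; rewrite tE !big_ord_recl big_ord0 /= expr0 expr1; ring.
Qed.

Lemma fig8_character_varietyE :
  fig8_character_variety K = zero_locus (fig8_equations K).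
Proof.
apply/seteqP; split; first exact: fig8_character_variety_sub.
move=> v /zero_locus_fig8_equations[v01 phi0].
apply/fig8_character_varietyP.
set x := tnth v 0 in v01 phi0; set z := tnth v 2 in phi0.
have vE : v = [tuple x; x; z] by rewrite [LHS]tuple3E -v01.
pose mat (a b c d : K) := \matrix_(i < 2, j < 2)
  (if i == 0 then if j == 0 then a else b else if j == 0 then c else d).
have detA : \det (mat x (-1) 1 0) == 1 by rewrite det_mx2 !mxE /=; apply/eqP; ring.
pose A := MkSL2 detA.
have trA : \tr (SL2_mx A) = x by rewrite /mxtrace big_ord2 !mxE /= addr0.
move/eqP: phi0; rewrite mulf_eq0 => /orP[/eqP zE | /eqP phi0].
  exists A, A; split; first by rewrite /fig8_relation mulVg mul1g mulgV mul1g mulg1.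
  rewrite mxtrace_sqr trA SL2_det vE; congr [tuple _; _; _].
  by apply/eqP; rewrite -subr_eq0 -oppr_eq0 -zE; apply/eqP; ring.
(* Among the matrices of trace [x], look for [B] with zero upper left entry and
   upper right entry [q]: the condition on [tr(AB)] makes the lower left entry
   [q - z], and [det B = 1] becomes [q^2 = z q - 1]. *)
have [q qE] := closed_field_quadratic z (-1).
have detB : \det (mat 0 q (q - z) x) == 1.
  by rewrite det_mx2 !mxE /=; apply/eqP; ring: qE.
pose B := MkSL2 detB.
have trB : \tr (SL2_mx B) = x by rewrite /mxtrace big_ord2 !mxE /= add0r.
have trAB : \tr (SL2_mx A *m SL2_mx B) = z.
  by rewrite /mxtrace big_ord2 !mulmx2E !mxE /=; ring.
exists A, B; split; last by rewrite trA trB trAB vE.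
by apply/fig8_relation_mx; rewrite trA ?trB // trAB phi0 scale0r.
Qed.

End Fig8ClosedField.

(** * Irreducible sets and components *)

Section ZariskiTopology.
Variable K : fieldType.

(** A set is irreducible when the polynomial functions on it form a domain. *)
Lemma zariski_irreducible_domain n (Z : set (n.-tuple K)) :
  Z !=set0 ->
  (forall p q : {mpoly K[n]}, (forall v, Z v -> p.@[tnth v] * q.@[tnth v] = 0) ->
    (forall v, Z v -> p.@[tnth v] = 0) \/ (forall v, Z v -> q.@[tnth v] = 0)) ->
  zariski_irreducible Z.
Proof.
move=> Z0 domZ; split=> // A B [S ->] [T ->] ZST.
apply: contrapT => /not_orP[/existsNP[v /not_implyP[Zv /existsNP[p /not_implyP[Sp pv]]]]].
move=> /existsNP[w /not_implyP[Zw /existsNP[q /not_implyP[Tq qw]]]].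
have [u Zu|/(_ v Zv)//|/(_ w Zw)//] := domZ p q.
by have [/(_ p Sp)->|/(_ q Tq)->] := ZST u Zu; rewrite ?mul0r ?mulr0.
Qed.

Lemma polynomial_map_closed n m (f : n.-tuple K -> m.-tuple K) Z :
  polynomial_map f -> zariski_closed Z -> zariski_closed (f @^-1` Z).
Proof.
move=> [P fE] [S ->]; exists [set p \mPo P | p in S].
have pfE (p : {mpoly K[m]}) v : (p \mPo P).@[tnth v] = p.@[tnth (f v)].
  by rewrite comp_mpoly_meval; apply: meval_eq => i; rewrite fE tnth_mktuple.
apply/seteqP; split=> v fv; first by move=> _ [p Sp <-]; rewrite pfE; exact: fv.
by move=> p Sp; rewrite -pfE; apply: fv; exists p.
Qed.

Lemma polynomial_map_irreducible n m (f : n.-tuple K -> m.-tuple K) Z :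
  polynomial_map f -> zariski_irreducible Z -> zariski_irreducible (f @` Z).
Proof.
move=> polf [[v Zv] irrZ]; split; first by exists (f v), v.
move=> A B clA clB /image_subP ZAB.
have [] := irrZ _ _ (polynomial_map_closed polf clA) (polynomial_map_closed polf clB) ZAB.
  by move=> ZA; left; apply/image_subP.
by move=> ZB; right; apply/image_subP.
Qed.

Lemma irreducible_components_setU n (A B : set (n.-tuple K)) :
  zariski_closed A -> zariski_closed B ->
  zariski_irreducible A -> zariski_irreducible B ->
  ~ A `<=` B -> ~ B `<=` A ->
  irreducible_components (A `|` B) = [set A; B].
Proof.
move=> clA clB irrA irrB nAB nBA; apply/seteqP; split=> [Z [irrZ ZAB maxZ]|Z].
  have [ZA|ZB] := irrZ.2 _ _ clA clB ZAB.
    by left; apply/esym/maxZ.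
  by right; apply/esym/maxZ.
case=> ->; split=> // W irrW WAB sW.
  have [WA|WB] := irrW.2 _ _ clA clB WAB; first exact/seteqP.
  by case: nAB; exact: subset_trans WB.
have [WA|WB] := irrW.2 _ _ clA clB WAB; last exact/seteqP.
by case: nBA; exact: subset_trans WA.
Qed.

Lemma iso_irreducible_component n m (V : set (n.-tuple K)) (W : set (m.-tuple K))
    f g Z :
  polynomial_map f -> polynomial_map g ->
  (forall v, V v -> W (f v) /\ g (f v) = v) ->
  (forall w, W w -> V (g w) /\ f (g w) = w) ->
  irreducible_components V Z -> irreducible_components W (f @` Z).
Proof.
move=> polf polg fV gW [irrZ ZV maxZ]; split.
- exact: polynomial_map_irreducible.
- by move=> _ [v /ZV/fV[Wfv _] <-].
move=> Y irrY YW fZY.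
have <- : g @` Y = Z.
  apply: maxZ; first exact: polynomial_map_irreducible.
    by move=> _ [w /YW/gW[Vgw _] <-].
  by move=> v Zv; exists (f v); [apply: fZY; exists v | exact: (fV _ (ZV _ Zv)).2].
rewrite image_comp; apply/seteqP; split=> [w Yw|_ [w Yw <-]].
  by exists w => //; exact: (gW _ (YW _ Yw)).2.
by rewrite /= (gW _ (YW _ Yw)).2.
Qed.

Lemma iso_irreducible_components n m (V : set (n.-tuple K)) (W : set (m.-tuple K))
    f A B :
  algebraic_iso V W f -> A <> B -> irreducible_components W = [set A; B] ->
  exists A' B', A' <> B' /\ irreducible_components V = [set A'; B'].
Proof.
move=> [g [polf polg fV gW]] nAB compW.
have fgK Z : irreducible_components W Z -> f @` (g @` Z) = Z.
  move=> [_ ZW _]; rewrite image_comp; apply/seteqP; split=> [_ [w Zw <-]|w Zw].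
    by rewrite /= (gW _ (ZW _ Zw)).2.
  by exists w => //; exact: (gW _ (ZW _ Zw)).2.
have gfK Z : irreducible_components V Z -> g @` (f @` Z) = Z.
  move=> [_ ZV _]; rewrite image_comp; apply/seteqP; split=> [_ [v Zv <-]|v Zv].
    by rewrite /= (fV _ (ZV _ Zv)).2.
  by exists v => //; exact: (fV _ (ZV _ Zv)).2.
have compA : irreducible_components W A by rewrite compW; left.
have compB : irreducible_components W B by rewrite compW; right.
exists (g @` A), (g @` B); split=> [eqAB|].
  by apply: nAB; rewrite -(fgK A) // eqAB fgK.
apply/seteqP; split=> [Z compZ|Z [] ->]; last 2 first.
- exact: iso_irreducible_component gW fV compA.
- exact: iso_irreducible_component gW fV compB.
have := iso_irreducible_component polf polg fV gW compZ.
by rewrite compW -{2}(gfK Z compZ) => -[->|->]; [left|right].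
Qed.

(** Induction on polynomial functions, pulled back along a family of points. *)
Lemma meval_ind n T (h : T -> 'I_n -> K) (P : (T -> K) -> Prop) :
  (forall c, P (fun=> c)) ->
  (forall a b, P a -> P b -> P (fun t => a t + b t)) ->
  (forall a b, P a -> P b -> P (fun t => a t * b t)) ->
  (forall i, P (fun t => h t i)) ->
  forall p : {mpoly K[n]}, P (fun t => p.@[h t]).
Proof.
move=> Pc PD PM Ph p.
have Psum I (r : seq I) F : (forall i, P (F i)) -> P (fun t => \sum_(i <- r) F i t).
  move=> PF; elim: r => [|i r IHr].
    by under eq_fun do rewrite big_nil.
  by under eq_fun do rewrite big_cons; exact: PD.
have Pprod I (r : seq I) F : (forall i, P (F i)) -> P (fun t => \prod_(i <- r) F i t).
  move=> PF; elim: r => [|i r IHr].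
    by under eq_fun do rewrite big_nil.
  by under eq_fun do rewrite big_cons; exact: PM.
under eq_fun do rewrite mevalE.
apply: Psum => m; apply: (PM) => //; apply: Pprod => i.
elim: (m i) => [|k IHk]; first by under eq_fun do rewrite expr0.
by under eq_fun do rewrite exprS; exact: PM.
Qed.

End ZariskiTopology.

(** * The plane curve and its two components *)

Section Fig8Curve.
Variable K : closedFieldType.

(** A nonconstant polynomial takes the value [-1], so [p] is constant. *)
Lemma closed_field_poly0 (p : {poly K}) : (forall t, p.[t] = 0) -> p = 0.
Proof.
move=> p0; have [/size_poly1P[c c0 pE]|/closed_rootP[t]] := boolP (size (p + 1) == 1%N).
  have {}pE : p = (c - 1)%:P by rewrite polyCB -pE addrK.
  by have := p0 0; rewrite pE hornerC => ->.
by rewrite /root hornerD hornerC p0 add0r oner_eq0.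
Qed.

(** Otherwise the two sides would have degrees of different parities. *)
Lemma odd_size_sqr (a b p q : {poly K}) :
  a != 0 -> b != 0 -> odd (size a) != odd (size b) ->
  a * p ^+ 2 = b * q ^+ 2 -> p = 0 /\ q = 0.
Proof.
move=> a0 b0 oddab E.
have [p0|p0] := eqVneq p 0; have [q0|q0] := eqVneq q 0 => //.
- by move/eqP: E; rewrite p0 expr0n mulr0 eq_sym mulf_eq0 (negPf b0) sqrf_eq0 (negPf q0).
- by move/eqP: E; rewrite q0 expr0n mulr0 mulf_eq0 (negPf a0) sqrf_eq0 (negPf p0).
have := congr1 (size \o val) E; rewrite /= !size_mul ?expf_neq0 //.
have := size_exp p 2; have := size_exp q 2.
move: oddab (a0) (b0) (p0) (q0) (expf_neq0 2 p0) (expf_neq0 2 q0).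
rewrite -!size_poly_gt0.
move: (size a) (size b) (size p) (size q) (size (p ^+ 2)) (size (q ^+ 2)).
lia.
Qed.

(** The component of the abelian representations, where [x^2 - z - 2 = 0]. *)
Definition fig8_abelian_curve : set (2.-tuple K) :=
  [set v | tnth v 1 = tnth v 0 ^+ 2 - 2].

(** The other component, which holds the characters of all irreducible
    representations: [z^2 - (1 + x^2) z + 2 x^2 - 1 = 0], with the terms in [x^2]
    collected on the left. *)
Definition fig8_canonical_curve : set (2.-tuple K) :=
  [set v | tnth v 0 ^+ 2 * (tnth v 1 - 2) = tnth v 1 ^+ 2 - tnth v 1 - 1].

Lemma fig8_plane_curveP (v : 2.-tuple K) :
  fig8_plane_curve K v <-> fig8_poly (tnth v 0) (tnth v 1) = 0.
Proof.
rewrite /fig8_plane_curve /zero_locus /=; split=> [/(_ _ erefl)|v0 _ ->];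
by rewrite rmorph_fig8_poly /= !mevalXU.
Qed.

Lemma fig8_plane_curveE :
  fig8_plane_curve K = fig8_abelian_curve `|` fig8_canonical_curve.
Proof.
apply/seteqP; split=> v.
  move/fig8_plane_curveP/eqP; rewrite mulf_eq0 => /orP[]/eqP phi0; [left|right].
    by apply/subr0_eq/oppr_inj; rewrite oppr0 -phi0; ring.
  by apply/subr0_eq/oppr_inj; rewrite oppr0 -phi0; ring.
rewrite /fig8_abelian_curve /fig8_canonical_curve /=.
by case=> v0; apply/fig8_plane_curveP/eqP; rewrite mulf_eq0; apply/orP; [left|right];
  apply/eqP; [rewrite v0 | apply: etrans (subrr (tnth v 0 ^+ 2 * (tnth v 1 - 2)));
    rewrite {1}v0]; ring.
Qed.

Lemma fig8_abelian_curve_closed : zariski_closed fig8_abelian_curve.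
Proof.
exists [set 'X_1 - ('X_0 ^+ 2 - 2)]; apply/seteqP; split=> v; rewrite /zero_locus /=.
  by move=> v0 _ ->; rewrite !(mevalB, rmorphXn, rmorph_nat) /= !mevalXU v0 subrr.
move/(_ _ erefl); rewrite !(mevalB, rmorphXn, rmorph_nat) /= !mevalXU.
exact: subr0_eq.
Qed.

Lemma fig8_canonical_curve_closed : zariski_closed fig8_canonical_curve.
Proof.
exists [set 'X_0 ^+ 2 * ('X_1 - 2) - ('X_1 ^+ 2 - 'X_1 - 1)].
apply/seteqP; split=> v; rewrite /zero_locus /=.
  move=> v0 _ ->.
  by rewrite !(mevalB, mevalM, rmorphXn, rmorph_nat, meval1) /= !mevalXU v0 subrr.
move/(_ _ erefl).
rewrite !(mevalB, mevalM, rmorphXn, rmorph_nat, meval1) /= !mevalXU.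
exact: subr0_eq.
Qed.

Lemma fig8_abelian_curve_irreducible : zariski_irreducible fig8_abelian_curve.
Proof.
pose pt (t : K) : 2.-tuple K := [tuple t; t ^+ 2 - 2].
have ptP t : fig8_abelian_curve (pt t) by [].
have onpt v : fig8_abelian_curve v -> v = pt (tnth v 0).
  by move=> v0; rewrite {1}[v]tuple2E v0.
apply: zariski_irreducible_domain; first by exists (pt 0).
have pullback (p : {mpoly K[2]}) :
    exists p' : {poly K}, forall t, p.@[tnth (pt t)] = p'.[t].
  apply: (meval_ind (h := fun t => tnth (pt t))
    (P := fun a => exists p' : {poly K}, forall t, a t = p'.[t])).
  - by move=> c; exists c%:P => t; rewrite hornerC.
  - by move=> a b [a' aE] [b' bE]; exists (a' + b') => t; rewrite hornerD aE bE.
  - by move=> a b [a' aE] [b' bE]; exists (a' * b') => t; rewrite hornerM aE bE.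
  - case=> -[|[|//]] lti.
      by exists 'X => t; rewrite hornerX (tnth_nth 0).
    by exists ('X^2 - 2%:P) => t; rewrite !hornerE (tnth_nth 0).
move=> p q; have [p' pE] := pullback p; have [q' qE] := pullback q => pq0.
have : p' * q' = 0.
  by apply: closed_field_poly0 => t; rewrite hornerM -pE -qE pq0.
by move/eqP; rewrite mulf_eq0 => /orP[]/eqP r0; [left|right] => v /onpt->;
  rewrite ?pE ?qE r0 horner0.
Qed.

Lemma fig8_canonical_curve_neq2 v : fig8_canonical_curve v -> tnth v 1 - 2 != 0.
Proof.
rewrite /fig8_canonical_curve /= subr_eq0 => vE; apply/eqP => v2.
move/eqP: vE; rewrite v2 subrr mulr0 (_ : 2 ^+ 2 - 2 - 1 = 1); last by ring.
by rewrite eq_sym oner_eq0.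
Qed.

Lemma fig8_canonical_curve_sqrM v : fig8_canonical_curve v ->
  tnth v 0 ^+ 2 * tnth v 1 =
    2 * tnth v 0 ^+ 2 + (tnth v 1 ^+ 2 - tnth v 1 - 1).
Proof. by move=> <-; ring. Qed.

Lemma fig8_canonical_curve_point z :
  z != 2 -> exists x, fig8_canonical_curve [tuple x; z].
Proof.
rewrite -subr_eq0 => z2.
have [x] := closed_field_quadratic 0 ((z ^+ 2 - z - 1) / (z - 2)).
rewrite mul0r add0r => xE; exists x.
by rewrite /fig8_canonical_curve /= !(tnth_nth 0) /= xE divfK.
Qed.

(** On the curve, [x^2] is a rational function of [z] whose only pole is at
    [z = 2]; clearing denominators leaves only the powers [1] and [x]. *)
Lemma fig8_canonical_normal_form (p : {mpoly K[2]}) :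
  exists N (p0 p1 : {poly K}), forall v, fig8_canonical_curve v ->
    (tnth v 1 - 2) ^+ N * p.@[tnth v] =
    p0.[tnth v 1] + tnth v 0 * p1.[tnth v 1].
Proof.
pose P a := exists N (p0 p1 : {poly K}), forall v, fig8_canonical_curve v ->
    (tnth v 1 - 2) ^+ N * a v = p0.[tnth v 1] + tnth v 0 * p1.[tnth v 1].
apply: (@meval_ind _ _ _ (fun v => tnth v) P) => {p}.
- by move=> c; exists 0%N, c%:P, 0 => v _; rewrite !hornerE; ring.
- move=> a b [N [a0 [a1 aE]]] [M [b0 [b1 bE]]]; exists (N + M)%N.
  exists (('X - 2%:P) ^+ M * a0 + ('X - 2%:P) ^+ N * b0).
  exists (('X - 2%:P) ^+ M * a1 + ('X - 2%:P) ^+ N * b1) => v vC.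
  transitivity ((tnth v 1 - 2) ^+ M * ((tnth v 1 - 2) ^+ N * a v) +
                (tnth v 1 - 2) ^+ N * ((tnth v 1 - 2) ^+ M * b v)).
    by rewrite exprD; ring.
  by rewrite aE // bE // !(hornerE, horner_exp); ring.
- move=> a b [N [a0 [a1 aE]]] [M [b0 [b1 bE]]]; exists (N + M).+1%N.
  exists (('X - 2%:P) * a0 * b0 + ('X ^+ 2 - 'X - 1) * a1 * b1).
  exists (('X - 2%:P) * (a0 * b1 + a1 * b0)) => v vC.
  transitivity ((tnth v 1 - 2) * ((tnth v 1 - 2) ^+ N * a v) *
                ((tnth v 1 - 2) ^+ M * b v)).
    by rewrite exprS exprD; ring.
  rewrite aE // bE // !(hornerE, horner_exp) /=.
  have vE := fig8_canonical_curve_sqrM vC; ring: vE.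
case=> -[|[|//]] lti.
- exists 0%N, 0, 1 => v _; rewrite !hornerE; congr tnth; exact: val_inj.
- exists 0%N, 'X, 0 => v _; rewrite !hornerE; congr tnth; exact: val_inj.
Qed.

Lemma fig8_canonical_curve_irreducible : zariski_irreducible fig8_canonical_curve.
Proof.
apply: zariski_irreducible_domain.
  have [|x xC] := @fig8_canonical_curve_point 1.
    by rewrite eq_sym -subr_eq0 (_ : 2 - 1 = 1) ?oner_neq0 //; ring.
  by exists [tuple x; 1].
move=> p q pq0.
have [N [p0 [p1 pE]]] := fig8_canonical_normal_form p.
have [M [q0 [q1 qE]]] := fig8_canonical_normal_form q.
pose a : {poly K} := 'X - 2%:P.
pose b : {poly K} := 'X^2 - 'X - 1.
(* [nrm r0 r1] is [z - 2] times the product of the two conjugates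
   [r0 + x r1] and [r0 - x r1]. *)
pose nrm (r0 r1 : {poly K}) := a * r0 ^+ 2 - b * r1 ^+ 2.
have nrmE r0 r1 x z : fig8_canonical_curve [tuple x; z] ->
    (nrm r0 r1).[z] = (z - 2) * (r0.[z] + x * r1.[z]) * (r0.[z] - x * r1.[z]).
  move=> /fig8_canonical_curve_sqrM; rewrite !(tnth_nth 0) /= => xz.
  by rewrite /nrm /a /b !(hornerE, horner_exp) /=; ring: xz.
have nrm0 : a * (nrm p0 p1 * nrm q0 q1) = 0.
  apply: closed_field_poly0 => z; rewrite hornerM [a.[z]]hornerXsubC.
  have [->|/fig8_canonical_curve_point[x xC]] := eqVneq z 2.
    by rewrite subrr mul0r.
  rewrite hornerM !(nrmE _ _ x) //.
  have : (p0.[z] + x * p1.[z]) * (q0.[z] + x * q1.[z]) = 0.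
    rewrite -(pE _ xC) -(qE _ xC).
    by rewrite mulrACA pq0 // mulr0.
  set u := _ + _; set w := _ + _ => uw0.
  by ring: uw0.
have sz_a : size a = 2%N by rewrite size_XsubC.
have sz_b : size b = 3%N.
  rewrite /b -addrA size_polyDl size_polyXn //.
  by rewrite -opprD size_polyN size_XaddC.
have nz_a : a != 0 by rewrite -size_poly_eq0 sz_a.
have nz_b : b != 0 by rewrite -size_poly_eq0 sz_b.
have vanish r L r0 r1 : nrm r0 r1 = 0 ->
    (forall v, fig8_canonical_curve v -> (tnth v 1 - 2) ^+ L * r.@[tnth v] =
      r0.[tnth v 1] + tnth v 0 * r1.[tnth v 1]) ->
    forall v, fig8_canonical_curve v -> r.@[tnth v] = 0.
  move=> /subr0_eq/odd_size_sqr[]; rewrite ?sz_a ?sz_b // => -> -> rE v vC.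
  have := rE v vC; rewrite !horner0 mulr0 addr0 => /eqP.
  rewrite mulf_eq0 expf_eq0 (negPf (fig8_canonical_curve_neq2 vC)) andbF.
  by move/eqP.
move/eqP: nrm0; rewrite !mulf_eq0 (negPf nz_a) /= => /orP[]/eqP n0.
  by left; exact: vanish n0 pE.
by right; exact: vanish n0 qE.
Qed.

Lemma fig8_abelian_curve_not_sub : ~ fig8_abelian_curve `<=` fig8_canonical_curve.
Proof.
move=> sub; have /sub/fig8_canonical_curve_neq2 : fig8_abelian_curve [tuple 2; 2].
  by rewrite /fig8_abelian_curve /= !(tnth_nth 0) /=; ring.
by rewrite (tnth_nth 0) /= subrr eqxx.
Qed.

Lemma fig8_canonical_curve_not_sub : ~ fig8_canonical_curve `<=` fig8_abelian_curve.
Proof.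
(* The parabola meets the curve only over [z = 3], and the curve has no point
   over [z = 2]; a root of [(z - 2)(z - 3) = 1] avoids both values in every
   characteristic. *)
have [z zE] := closed_field_quadratic (5 : K) (- 5).
have zE1 : (z - 2) * (z - 3) = 1 by ring: zE.
have /fig8_canonical_curve_point[x xC] : z != 2.
  rewrite -subr_eq0; apply: contraTneq (oner_neq0 K) => z2.
  by rewrite -zE1 z2 mul0r eqxx.
move=> /(_ _ xC); rewrite /fig8_abelian_curve /= !(tnth_nth 0) /= => zx.
have := oner_neq0 K; rewrite -zE1 mulf_eq0 negb_or => /andP[_].
move/fig8_canonical_curve_sqrM: xC; rewrite !(tnth_nth 0) /= => xC.
have xE : x ^+ 2 = z + 2 by rewrite zx; ring.
have -> : z - 3 = x ^+ 2 * z - (2 * x ^+ 2 + (z ^+ 2 - z - 1)) by rewrite xE; ring.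
by rewrite xC subrr eqxx.
Qed.

Lemma fig8_plane_curve_components :
  irreducible_components (fig8_plane_curve K) =
    [set fig8_abelian_curve; fig8_canonical_curve].
Proof.
rewrite fig8_plane_curveE; apply: irreducible_components_setU.
- exact: fig8_abelian_curve_closed.
- exact: fig8_canonical_curve_closed.
- exact: fig8_abelian_curve_irreducible.
- exact: fig8_canonical_curve_irreducible.
- exact: fig8_abelian_curve_not_sub.
- exact: fig8_canonical_curve_not_sub.
Qed.

Lemma proj_xz_iso :
  algebraic_iso (zero_locus (fig8_equations K)) (fig8_plane_curve K) (proj_xz K).
Proof.
exists (fun w => [tuple tnth w 0; tnth w 0; tnth w 1]); split.
- exists [tuple 'X_0; 'X_2] => v; apply: eq_from_tnth => -[[|[|//]] lti];
  by rewrite tnth_mktuple !(tnth_nth 0) /= mevalXU (tnth_nth 0).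
- exists [tuple 'X_0; 'X_0; 'X_1] => v.
  apply: eq_from_tnth => -[[|[|[|//]]] lti];
  by rewrite tnth_mktuple !(tnth_nth 0) /= mevalXU (tnth_nth 0).
- move=> v /zero_locus_fig8_equations[v01 v0]; split.
    by apply/fig8_plane_curveP; rewrite !(tnth_nth 0).
  have e0 : tnth (proj_xz K v) 0 = tnth v 0 by rewrite (tnth_nth 0).
  have e1 : tnth (proj_xz K v) 1 = tnth v 2 by rewrite (tnth_nth 0).
  by rewrite e0 e1 [RHS]tuple3E -v01.
- move=> w /fig8_plane_curveP w0; split.
    apply/zero_locus_fig8_equations; move: w0; rewrite !(tnth_nth 0) /=.
    by split.
  by rewrite [RHS]tuple2E /proj_xz; congr [tuple _; _]; rewrite (tnth_nth 0).
Qed.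

End Fig8Curve.

Theorem proposition4p1 (R : realType) :
  [/\ fig8_character_variety R[i] = zero_locus (fig8_equations R[i]),
      algebraic_iso (fig8_character_variety R[i]) (fig8_plane_curve R[i])
        (proj_xz R[i]),
      (exists A B : set (3.-tuple R[i]), A <> B /\
        irreducible_components (fig8_character_variety R[i]) = [set A; B]) &
      (exists A B : set (2.-tuple R[i]), A <> B /\
        irreducible_components (fig8_plane_curve R[i]) = [set A; B])].
Proof.
have compE := fig8_plane_curve_components R[i].
have isoP := proj_xz_iso R[i].
have neqAB : fig8_abelian_curve (K := R[i]) <> fig8_canonical_curve (K := R[i]).
  by move=> eqAB; apply: (@fig8_abelian_curve_not_sub R[i]); rewrite eqAB.
rewrite fig8_character_varietyE; split=> //.
- exact: iso_irreducible_components isoP neqAB compE.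
- by exists (@fig8_abelian_curve R[i]), (@fig8_canonical_curve R[i]).
Qed.
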